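(* Let $\mathbb S^1=\{(x,y)\in\mathbb R^2: x^2+y^2=1\}$ and let $\mathrm{sgn}$ be the sign function on $\mathbb R$. Then $$o_{\mathbb R}\colon(\mathbb S^1)^3\to\{-1,0,1\},\qquad (z_1,z_2,z_3)\mapsto \mathrm{sgn}\big(\det(z_2-z_1,\,z_3-z_2)\big)$$ defines a cyclic order on $\mathbb S^1$. In coordinates, for $(x_1,y_1),(x_2,y_2),(x_3,y_3)\in\mathbb S^1$, $$o_{\mathbb R}((x_1,y_1),(x_2,y_2),(x_3,y_3))=\mathrm{sgn}\big((y_3-y_2)(x_2-x_1)-(y_2-y_1)(x_3-x_2)\big).$$ Moreover, for every real closed field $\mathbb F$, $o_{\mathbb R}$ extends (by the same formula, with the sign function of $\mathbb F$) to a cyclic order on $\mathbb S^1(\mathbb F)=\{(x,y)\in\mathbb F^2:x^2+y^2=1\}$ which is $\mathrm{PSL}_2(\mathbb F)$-invariant.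
   Context: A cyclic order on a set $\Omega$ is a function $o\colon\Omega^3\to\{-1,0,1\}$ such that (1) $o(z_1,z_2,z_3)=0$ iff $\mathrm{Card}\{z_1,z_2,z_3\}\le2$; (2) $o(z_1,z_2,z_3)=o(z_2,z_3,z_1)=-o(z_1,z_3,z_2)$ for all $z_1,z_2,z_3$; (3) if $o(z_1,z_2,z_3)=1=o(z_1,z_3,z_4)$ then $o(z_1,z_2,z_4)=1$. $\mathrm{PSL}_2(\mathbb F)$ acts on $\mathbb S^1(\mathbb F)$, viewed as the unit circle in $\mathbb F[i]$ ($i^2=-1$) bounding the disc model $\{z\in\mathbb F[i]:\|z\|<1\}$ of the hyperbolic plane over $\mathbb F$, by Möbius transformations; that is, the standard action of $\mathrm{PSL}_2(\mathbb F)$ on the projective line $\mathbb P^1(\mathbb F)=\mathbb F\cup\{\infty\}$ transported to the unit circle via the Cayley transform $w\mapsto (w-i)/(w+i)$. *)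

(* Defs.v *)
From HB Require Import structures.
From mathcomp Require Import all_boot all_order all_algebra.
From mathcomp Require Import generic_quotient ring lra.
From mathcomp Require Import complex.

Set Implicit Arguments.
Unset Strict Implicit.
Unset Printing Implicit Defensive.

Import Order.TTheory GRing.Theory Num.Theory.

Local Open Scope ring_scope.
Local Open Scope quotient_scope.
Local Open Scope complex_scope.

(* The codomain {-1, 0, 1} is the range condition on an [int]-valued map;
   [size (undup _)] is the cardinality of the underlying set. *)
Record cyclic_order (T : eqType) (o : T -> T -> T -> int) : Prop :=
  CyclicOrder {
    cyclic_order_range : forall z1 z2 z3, o z1 z2 z3 \in [:: -1; 0; 1];
    cyclic_order_eq0 : forall z1 z2 z3,
      o z1 z2 z3 = 0 <-> (size (undup [:: z1; z2; z3]) <= 2)%N;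
    cyclic_order_perm : forall z1 z2 z3,
      o z1 z2 z3 = o z2 z3 z1 /\ o z2 z3 z1 = - o z1 z3 z2;
    cyclic_order_trans : forall z1 z2 z3 z4,
      o z1 z2 z3 = 1 -> o z1 z3 z4 = 1 -> o z1 z2 z4 = 1
  }.

Definition on_circle (F : rcfType) (p : F * F) : bool :=
  p.1 ^+ 2 + p.2 ^+ 2 == 1.

Record circle (F : rcfType) :=
  Circle { circle_pt : F * F; circle_ptP : on_circle circle_pt }.

HB.instance Definition _ (F : rcfType) := [isSub for @circle_pt F].
HB.instance Definition _ (F : rcfType) := [Choice of circle F by <:].

Definition circle_vec (F : rcfType) (z : circle F) : 'cV[F]_2 :=
  \col_i (if i == 0 then (circle_pt z).1 else (circle_pt z).2).

Definition circle_order (F : rcfType) (z1 z2 z3 : circle F) : int :=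
  sgz (\det (row_mx (circle_vec z2 - circle_vec z1)
                    (circle_vec z3 - circle_vec z2) : 'M[F]_2)).

Lemma circle_map_subproof (K F : rcfType) (f : {rmorphism K -> F})
    (z : circle K) : on_circle (f (circle_pt z).1, f (circle_pt z).2).
Proof.
case: z => -[x y] /eqP /= h; rewrite /on_circle /=.
by rewrite -!rmorphXn -rmorphD h rmorph1.
Qed.

Definition circle_map (K F : rcfType) (f : {rmorphism K -> F})
    (z : circle K) : circle F :=
  Circle (circle_map_subproof f z).

(* The projective line is [option F], with [None] the point at infinity. *)
Definition mobius (F : fieldType) (g : 'M[F]_2) (w : option F) : option F :=
  let a := g 0 0 in let b := g 0 1 in let c := g 1 0 in let d := g 1 1 in
  match w with
  | Some x => if c * x + d == 0 then None else Some ((a * x + b) / (c * x + d))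
  | None => if c == 0 then None else Some (a / c)
  end.

Definition circle_complex (F : rcfType) (z : circle F) : F[i] :=
  (circle_pt z).1 +i* (circle_pt z).2.

Definition cayley_complex (F : rcfType) (w : option F) : F[i] :=
  if w is Some x then (x%:C - 'i) / (x%:C + 'i) else 1.

Lemma cayley_complexE (F : rcfType) (x : F) :
  cayley_complex (Some x) =
  ((x ^+ 2 - 1) / (x ^+ 2 + 1)) +i* (- (x *+ 2) / (x ^+ 2 + 1)).
Proof.
have n0 : x ^+ 2 + 1 != 0 by rewrite gt_eqF // ltr_wpDl ?sqr_ge0.
have d0 : x%:C + 'i != 0 :> F[i].
  by rewrite eq_complex /= add0r oner_eq0 andbF.
apply: (canLR (mulfK d0)); apply/eqP; rewrite eq_complex /=.
by apply/andP; split; apply/eqP; field.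
Qed.

Lemma cayley_subproof (F : rcfType) (w : option F) :
  on_circle (complex.Re (cayley_complex w), complex.Im (cayley_complex w)).
Proof.
case: w => [x|]; last by rewrite /on_circle /= expr1n expr0n addr0.
have n0 : x ^+ 2 + 1 != 0 by rewrite gt_eqF // ltr_wpDl ?sqr_ge0.
by rewrite cayley_complexE /on_circle /=; apply/eqP; field.
Qed.

Definition cayley (F : rcfType) (w : option F) : circle F :=
  Circle (cayley_subproof w).

(* 'i (1 + z) / (1 - z) lies in F for z on the unit circle, z != 1, hence
   the real part; [cayleyK] and [cayley_invK] show that this is the inverse. *)
Definition cayley_inv (F : rcfType) (z : circle F) : option F :=
  let u := circle_complex z in
  if u == 1 then None else Some (complex.Re ('i * (1 + u) / (1 - u))).

Lemma cayley_invE (F : rcfType) (z : circle F) :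
  cayley_inv z =
  let: (x, y) := circle_pt z in
  if x == 1 then None else Some (- y / (1 - x)).
Proof.
case: z => -[x y] h; rewrite /cayley_inv /circle_complex.
have /eqP /= {}h := h.
rewrite -[LHS]/(if (x +i* y == 1) then None
  else Some (complex.Re ('i * (1 + (x +i* y)) / (1 - (x +i* y))))).
rewrite -[RHS]/(if x == 1 then None else Some (- y / (1 - x))).
rewrite eq_complex -[_ && _]/((x == 1) && (y == 0)).
have [x1|x1] := eqVneq x 1.
  suff -> : y = 0 by rewrite eqxx.
  by apply/eqP; rewrite -sqrf_eq0; apply/eqP; move: h; rewrite x1; lra.
have x1' : 1 - x != 0 by rewrite subr_eq0 eq_sym.
congr Some.
suff -> : 'i * (1 + (x +i* y)) / (1 - (x +i* y)) = (- y / (1 - x))%:C :> F[i].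
  by [].
have d0 : 1 - (x +i* y) != 0 :> F[i].
  by rewrite eq_complex /= (negPf x1').
apply: (canLR (mulfK d0)); apply/eqP; rewrite eq_complex /=.
have yy : y * y = (1 - x) * (1 + x) by move: h; rewrite !expr2; lra.
apply/andP; split; apply/eqP; first by field.
have -> : - y / (1 - x) * (0 - y) + 0 * (1 - x) = y * y / (1 - x) by field.
by rewrite yy; field.
Qed.

Lemma cayleyK (F : rcfType) : cancel (@cayley F) (@cayley_inv F).
Proof.
case=> [x|]; rewrite cayley_invE; last by rewrite /= eqxx.
have n0 : x ^+ 2 + 1 != 0 by rewrite gt_eqF // ltr_wpDl ?sqr_ge0.
rewrite /cayley /circle_pt cayley_complexE /=.
have e : 1 - (x ^+ 2 - 1) / (x ^+ 2 + 1) = 2 / (x ^+ 2 + 1) by field.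
case: eqP => [h|_].
  move: e; rewrite h subrr => /esym/eqP.
  by rewrite mulf_eq0 invr_eq0 (negPf n0) pnatr_eq0.
by rewrite e; congr Some; field; rewrite n0.
Qed.

Lemma cayley_invK (F : rcfType) : cancel (@cayley_inv F) (@cayley F).
Proof.
move=> z; apply: val_inj; rewrite cayley_invE.
case: z => -[x y] /= h; have /eqP /= {}h := h.
have yy : y ^+ 2 = (1 - x) * (1 + x) by move: h; rewrite !expr2; lra.
have [x1|x1] := eqVneq x 1.
  congr pair; first by rewrite x1.
  by apply/esym/eqP; rewrite -sqrf_eq0 yy x1 subrr mul0r.
have x1' : 1 - x != 0 by rewrite subr_eq0 eq_sym.
rewrite cayley_complexE /=.
have -> : (- y / (1 - x)) ^+ 2 = (1 + x) / (1 - x).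
  by rewrite expr_div_n sqrrN yy; field.
have e : (1 + x) / (1 - x) + 1 = 2 / (1 - x) by field.
rewrite e; congr pair; by field; rewrite x1'.
Qed.

Record SL2 (F : rcfType) :=
  MkSL2 { sl2_mx : 'M[F]_2; sl2_det : \det sl2_mx == 1 }.

HB.instance Definition _ (F : rcfType) := [isSub for @sl2_mx F].
HB.instance Definition _ (F : rcfType) := [Choice of SL2 F by <:].

Definition sl2_eqpm (F : rcfType) : rel (SL2 F) :=
  fun g h => (sl2_mx g == sl2_mx h) || (sl2_mx g == - sl2_mx h).

Lemma sl2_eqpm_equiv (F : rcfType) : equiv_class_of (@sl2_eqpm F).
Proof.
split=> [g|g h|h g k]; rewrite /sl2_eqpm ?eqxx //.
  by rewrite eq_sym [RHS]orbC orbC -eqr_oppLR eq_sym.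
case/orP=> /eqP e; case/orP=> /eqP e'; rewrite e e' ?opprK ?eqxx ?orbT //.
Qed.

Canonical sl2_equiv (F : rcfType) := EquivRelPack (sl2_eqpm_equiv F).

Definition PSL2 (F : rcfType) := {eq_quot (sl2_equiv F)}.

HB.instance Definition _ (F : rcfType) := Choice.on (PSL2 F).
HB.instance Definition _ (F : rcfType) := EqQuotient.on (PSL2 F).

Definition sl2_act (F : rcfType) (g : SL2 F) (z : circle F) : circle F :=
  cayley (mobius (sl2_mx g) (cayley_inv z)).

Definition psl2_act (F : rcfType) (g : PSL2 F) (z : circle F) : circle F :=
  sl2_act (repr g) z.

Lemma mobiusN (F : fieldType) (g : 'M[F]_2) : mobius (- g) =1 mobius g.
Proof.
case=> [x|] /=; rewrite !mxE.
  by rewrite !mulNr -!opprD oppr_eq0 invrN mulrNN.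
by rewrite oppr_eq0 invrN mulrNN.
Qed.

Lemma psl2_actE (F : rcfType) (g : SL2 F) :
  psl2_act (\pi_(PSL2 F) g) =1 sl2_act g.
Proof.
move=> z; rewrite /psl2_act.
have : sl2_eqpm (repr (\pi_(PSL2 F) g)) g.
  by apply/(@eqmodP _ (sl2_equiv F)); rewrite reprK.
by case/orP=> /eqP e; rewrite /sl2_act e // mobiusN.
Qed.

(* Main.v *)
Require Import Defs.
From mathcomp Require Import all_boot all_order all_algebra.
From mathcomp Require Import reals.
From mathcomp Require Import ring.
Set Implicit Arguments.
Unset Strict Implicit.
Unset Printing Implicit Defensive.

Import Order.TTheory GRing.Theory Num.Theory.
Local Open Scope ring_scope.

(** In homogeneous coordinates [P = (p, q)] on the projective line the Cayley
transform is [(p - i q) / (p + i q)].  Writing [ij] for the 2x2 determinant of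
[Pi] and [Pj], the determinant defining the order becomes
[4 [12] [23] [31] / (|P1|^2 |P2|^2 |P3|^2)], whose sign is that of
[[12] [23] [31]].  It does not change when a [Pi] is rescaled or when a matrix
of determinant 1 is applied, which gives invariance; it vanishes exactly when
two of the points coincide; and transitivity follows from the Plücker relation
[[13] [24] = [12] [34] + [14] [23]]. *)

(** The equalities are listed cyclically to match, one by one, the three factors of [orient]. *)
Lemma size_undup3_le2 (T : eqType) (a b c : T) :
  (size (undup [:: a; b; c]) <= 2)%N = [|| a == b, b == c | c == a].
Proof.
rewrite /= !inE [c == a]eq_sym.
by case: (a == b); case: (a == c); case: (b == c).
Qed.

Lemma sgz_range (R : realDomainType) (x : R) : sgz x \in [:: -1; 0; 1].
Proof. by case: sgzP; rewrite !inE. Qed.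

(** Positive elements of a real closed field are squares, so a ring morphism preserves positivity
    without being assumed monotone. *)
Lemma rmorph_sgz (K F : rcfType) (f : {rmorphism K -> F}) (x : K) :
  sgz (f x) = sgz x.
Proof.
have pos (y : K) : 0 < y -> 0 < f y.
  move=> y0; rewrite lt0r fmorph_eq0 gt_eqF //=.
  have -> : y = Num.sqrt y ^+ 2 by rewrite sqr_sqrtr ?ltW.
  by rewrite rmorphXn sqr_ge0.
have [x0|x0|x0] := sgzP x; first by rewrite x0 rmorph0 sgz0.
  by rewrite gtr0_sgz ?pos.
by rewrite ltr0_sgz // -oppr_gt0 -rmorphN pos // oppr_gt0.
Qed.

Lemma det_mx22 (R : comPzRingType) (A : 'M[R]_2) :
  \det A = A 0 0 * A 1 1 - A 0 1 * A 1 0.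
Proof.
rewrite (expand_det_row _ 0) !big_ord_recl big_ord0 addr0.
rewrite /cofactor !det_mx11 !mxE /= !expr0 !expr1 mul1r mulN1r mulrN.
by congr (_ * A _ _ - A _ _ * A _ _); apply: val_inj.
Qed.

Lemma circle_orderE (F : rcfType) (z1 z2 z3 : circle F) :
  circle_order z1 z2 z3 =
  let p1 := circle_pt z1 in let p2 := circle_pt z2 in let p3 := circle_pt z3 in
  sgz ((p3.2 - p2.2) * (p2.1 - p1.1) - (p2.2 - p1.2) * (p3.1 - p2.1)).
Proof.
rewrite /circle_order /circle_vec.
case: z1 z2 z3 => -[x1 y1] h1 [[x2 y2] h2] [[x3 y3] h3] /=.
(* The columns of [row_mx] are indexed by ['I_(1 + 1)]: column 0 lies in the left block and column 1
   in the right one. *)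
have split0 : split (0 : 'I_(1 + 1)) = inl 0.
  by rewrite -[RHS]unsplitK; congr split; apply: val_inj.
have split1 : split (1 : 'I_(1 + 1)) = inr 0.
  by rewrite -[RHS]unsplitK; congr split; apply: val_inj.
rewrite det_mx22 !mxE split0 split1 !mxE /=; congr sgz; ring.
Qed.

Definition homog (F : fieldType) (w : option F) : F * F :=
  if w is Some x then (x, 1) else (1, 0).

Definition bracket (F : pzRingType) (P Q : F * F) : F := P.1 * Q.2 - P.2 * Q.1.

Definition orient (F : pzRingType) (P Q S : F * F) : F :=
  bracket P Q * bracket Q S * bracket S P.

Lemma bracket_homog_eq0 (F : fieldType) (v w : option F) :
  (bracket (homog v) (homog w) == 0) = (v == w).
Proof.
case: v w => [x|] [y|] //=;
  rewrite /bracket /= ?(mulr1, mul1r, mulr0, mul0r, subr0, sub0r, subrr)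
    ?oppr_eq0 ?oner_eq0 ?eqxx // subr_eq0.
by apply/eqP/eqP => [->|[->]].
Qed.

Definition sqnorm (F : pzRingType) (P : F * F) : F := P.1 ^+ 2 + P.2 ^+ 2.

Lemma sqnorm_homog_gt0 (F : rcfType) (w : option F) : 0 < sqnorm (homog w).
Proof.
by case: w => [x|]; rewrite /sqnorm /= expr1n ?expr0n ?addr0 // ltr_wpDl ?sqr_ge0.
Qed.

(** Multiplying above and below by [p - i q] turns [(p - i q) / (p + i q)] into
    [(p - i q)^2 / (p^2 + q^2)], which also covers the point at infinity. *)
Lemma circle_pt_cayley (F : rcfType) (w : option F) (P := homog w) :
  circle_pt (cayley w) =
  ((P.1 ^+ 2 - P.2 ^+ 2) / sqnorm P, - (P.1 * P.2 *+ 2) / sqnorm P).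
Proof.
rewrite {}/P /cayley /circle_pt /sqnorm.
case: w => [x|]; first by rewrite cayley_complexE /= expr1n mulr1.
by rewrite /= expr1n expr0n /= mulr0 mul0rn oppr0 mul0r addr0 divr1.
Qed.

Lemma circle_order_cayley (F : rcfType) (u v w : option F) :
  circle_order (cayley u) (cayley v) (cayley w) =
  sgz (orient (homog u) (homog v) (homog w)).
Proof.
rewrite circle_orderE !circle_pt_cayley.
have := sqnorm_homog_gt0 u; have := sqnorm_homog_gt0 v.
have := sqnorm_homog_gt0 w.
move: (homog u) (homog v) (homog w) => [p1 q1] [p2 q2] [p3 q3].
rewrite /orient /bracket /sqnorm /= => N3 N2 N1.
set T := _ * _ * (p3 * q1 - _).
(* With denominators cleared, the determinant is that of the rows [(p^2 - q^2, -2 p q, p^2 + q^2)].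
   The change of basis from [(p^2, p q, q^2)] has determinant -4, and the Vandermonde determinant
   that remains is minus the product of the brackets; hence the 4. *)
transitivity (sgz (4 / ((p1 ^+ 2 + q1 ^+ 2) * (p2 ^+ 2 + q2 ^+ 2) *
   (p3 ^+ 2 + q3 ^+ 2)) * T)); last first.
  by rewrite sgzM gtr0_sgz ?mul1r // divr_gt0 ?mulr_gt0 ?ltr0n.
congr sgz; rewrite /T; field.
by rewrite !gt_eqF.
Qed.

Lemma circle_order_orient (F : rcfType) (z1 z2 z3 : circle F) :
  circle_order z1 z2 z3 =
  sgz (orient (homog (cayley_inv z1)) (homog (cayley_inv z2))
              (homog (cayley_inv z3))).
Proof. by rewrite -circle_order_cayley !cayley_invK. Qed.

Lemma orient_trans (F : rcfType) (P1 P2 P3 P4 : F * F) :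
  0 < orient P1 P2 P3 -> 0 < orient P1 P3 P4 -> 0 < orient P1 P2 P4.
Proof.
move=> T123 T134.
(* This is the Plücker relation multiplied by [[12] [13] [41]], so that each term is a square times
   an [orient]. *)
have e : bracket P1 P3 ^+ 2 * orient P1 P2 P4 =
    bracket P1 P2 ^+ 2 * orient P1 P3 P4 + bracket P4 P1 ^+ 2 * orient P1 P2 P3.
  by rewrite /orient /bracket; ring.
have b12 : bracket P1 P2 != 0.
  by apply: contraTneq T123; rewrite /orient => ->; rewrite !mul0r ltxx.
have b13 : bracket P1 P3 != 0.
  by apply: contraTneq T134; rewrite /orient => ->; rewrite !mul0r ltxx.
have b13_2 : 0 < bracket P1 P3 ^+ 2 by rewrite exprn_even_gt0.
rewrite -(pmulr_rgt0 _ b13_2) e.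
apply: ltr_pwDl; first by rewrite mulr_gt0 ?exprn_even_gt0.
by rewrite mulr_ge0 ?sqr_ge0 ?ltW.
Qed.

Lemma circle_order_cyclic (F : rcfType) : cyclic_order (@circle_order F).
Proof.
split=> [z1 z2 z3|z1 z2 z3|z1 z2 z3|z1 z2 z3 z4].
- exact: sgz_range.
- rewrite size_undup3_le2 circle_order_orient.
  rewrite -!(inj_eq (can_inj (@cayley_invK F))) -!bracket_homog_eq0.
  by rewrite orbA -!mulf_eq0 -sgz_eq0; split=> /eqP.
- rewrite !circle_order_orient -sgzN; split; congr sgz;
    rewrite /orient /bracket; ring.
- rewrite !circle_order_orient => /eqP + /eqP.
  rewrite !sgz_cp0 => T123 T134; apply/eqP; rewrite sgz_cp0.
  exact: orient_trans T123 T134.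
Qed.

Definition mxact (F : pzRingType) (g : 'M[F]_2) (P : F * F) : F * F :=
  (g 0 0 * P.1 + g 0 1 * P.2, g 1 0 * P.1 + g 1 1 * P.2).

Lemma bracket_mxact (F : comPzRingType) (g : 'M[F]_2) (P Q : F * F) :
  bracket (mxact g P) (mxact g Q) = \det g * bracket P Q.
Proof. rewrite det_mx22 /bracket /mxact /=; ring. Qed.

(** The scalar is the second coordinate of the image vector if that is nonzero, and the first one
    otherwise; both cannot vanish because [g] is invertible. *)
Lemma homog_mobius (F : fieldType) (g : 'M[F]_2) (w : option F) :
  \det g != 0 -> exists2 c : F, c != 0 &
    mxact g (homog w) = (c * (homog (mobius g w)).1, c * (homog (mobius g w)).2).
Proof.
rewrite det_mx22 /mxact; case: w => [x|] /= dg; rewrite ?mulr1 ?mulr0 ?addr0.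
  case: eqP => [den0|/eqP den0]; last first.
    by exists (g 1 0 * x + g 1 1); rewrite //= mulr1 mulrCA mulfV // mulr1.
  exists (g 0 0 * x + g 0 1); last by rewrite /= den0 mulr1 mulr0.
  apply: contraNneq dg => num0.
  (* The determinant as a combination of numerator and denominator: it would vanish with both. *)
  have e : (g 0 0 * g 1 1 - g 0 1 * g 1 0) =
     g 0 0 * (g 1 0 * x + g 1 1) - g 1 0 * (g 0 0 * x + g 0 1) by ring.
  by rewrite e den0 num0 !mulr0 subrr.
case: eqP => [c0|/eqP c0]; last first.
  by exists (g 1 0); rewrite //= mulr1 mulrCA mulfV // mulr1.
exists (g 0 0); last by rewrite /= c0 mulr1 mulr0.
by apply: contraNneq dg => a0; rewrite a0 c0 mul0r mulr0 subrr.
Qed.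

(** Each point enters two brackets, so the factor is a square and even negative scalars keep the
    sign. *)
Lemma orient_scale (F : comPzRingType) (a b c : F) (P Q S : F * F) :
  orient (a * P.1, a * P.2) (b * Q.1, b * Q.2) (c * S.1, c * S.2) =
  (a * b * c) ^+ 2 * orient P Q S.
Proof. rewrite /orient /bracket /=; ring. Qed.

Lemma sl2_act_order (F : rcfType) (g : SL2 F) (z1 z2 z3 : circle F) :
  circle_order (sl2_act g z1) (sl2_act g z2) (sl2_act g z3) =
  circle_order z1 z2 z3.
Proof.
rewrite circle_order_cayley circle_order_orient.
have dg : \det (sl2_mx g) = 1 by apply/eqP/sl2_det.
have dg0 : \det (sl2_mx g) != 0 by rewrite dg oner_neq0.
move: (cayley_inv z1) (cayley_inv z2) (cayley_inv z3) => w1 w2 w3.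
have [a a0 ea] := homog_mobius w1 dg0.
have [b b0 eb] := homog_mobius w2 dg0.
have [c c0 ec] := homog_mobius w3 dg0.
have <- : orient (mxact (sl2_mx g) (homog w1)) (mxact (sl2_mx g) (homog w2))
    (mxact (sl2_mx g) (homog w3)) = orient (homog w1) (homog w2) (homog w3).
  by rewrite /orient !bracket_mxact dg !mul1r.
rewrite ea eb ec orient_scale [RHS]sgzM [X in X * _]gtr0_sgz ?mul1r //.
by rewrite exprn_even_gt0 //= !mulf_neq0.
Qed.

Lemma circle_order_map (K F : rcfType) (f : {rmorphism K -> F})
    (z1 z2 z3 : circle K) :
  circle_order (circle_map f z1) (circle_map f z2) (circle_map f z3) =
  circle_order z1 z2 z3.
Proof.
by rewrite !circle_orderE /= -!rmorphB -!rmorphM -rmorphB rmorph_sgz.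
Qed.

Theorem lemma3p13 (R : realType) :
  cyclic_order (@circle_order R) /\
  (forall (x1 y1 x2 y2 x3 y3 : R)
     (h1 : on_circle (x1, y1)) (h2 : on_circle (x2, y2))
     (h3 : on_circle (x3, y3)),
     circle_order (Circle h1) (Circle h2) (Circle h3) =
     sgz ((y3 - y2) * (x2 - x1) - (y2 - y1) * (x3 - x2))) /\
  (forall F : rcfType,
     cyclic_order (@circle_order F) /\
     (forall (f : {rmorphism R -> F}) (z1 z2 z3 : circle R),
        circle_order (circle_map f z1) (circle_map f z2) (circle_map f z3) =
        circle_order z1 z2 z3) /\
     (forall (g : PSL2 F) (z1 z2 z3 : circle F),
        circle_order (psl2_act g z1) (psl2_act g z2) (psl2_act g z3) =
        circle_order z1 z2 z3)).
Proof.
split; first exact: circle_order_cyclic.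
split=> [x1 y1 x2 y2 x3 y3 h1 h2 h3|F].
  exact: (circle_orderE (Circle h1) (Circle h2) (Circle h3)).
split; first exact: circle_order_cyclic.
(* [psl2_act] unfolds to [sl2_act] at a representative, so invariance under [SL2] applies by
   conversion. *)
by split=> [f|g] z1 z2 z3; [exact: circle_order_map|exact: sl2_act_order].
Qed.
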